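(* Let $p$ and $d$ be integers such that $p$ and $d-p$ are nonnegative. If $p$ and $d-p$ do not share any common ones in their binary expansions, then $$\mathrm{coind}(\mathrm{AEmb}_d(\partial\Delta_{p+1},\mathbb{R}^d)) = d-p-1.$$
   Context: $\partial\Delta_{p+1}$ is the boundary complex of the $(p+1)$-dimensional simplex (which has $p+2$ vertices): all proper subsets of the vertex set are faces. For a simplicial complex $\Sigma$, a continuous map $f$ from (the geometric realization of) $\Sigma$ to $\mathbb{R}^d$ is an almost-embedding if $f(\sigma)\cap f(\tau)=\emptyset$ for any two vertex-disjoint faces $\sigma,\tau$ of $\Sigma$. $\mathrm{AEmb}(\Sigma,\mathbb{R}^d)$ is the space of almost-embeddings with the compact-open topology, and $\mathrm{AEmb}_d(\Sigma,\mathbb{R}^d)$ is this space with the $\mathbb{Z}/2$-action in which the generator sends $f$ to $-f$. The coindex $\mathrm{coind}(Y)$ of a $\mathbb{Z}/2$-space $Y$ is the largest integer $k$ such that there is a continuous $\mathbb{Z}/2$-equivariant map $S^k\to Y$, where $S^k$ carries the antipodal action; by convention $S^{-1}=\emptyset$, so $\mathrm{coind}(\emptyset)=-1$. Two nonnegative integers share a common one in their binary expansions if there is a position in which both have binary digit 1. *)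

(* Defs.v *)
From HB Require Import structures.
From mathcomp Require Import all_boot all_order all_algebra.
From mathcomp Require Import all_classical all_reals all_analysis.

Set Implicit Arguments.
Unset Strict Implicit.
Unset Printing Implicit Defensive.

Import Order.TTheory GRing.Theory Num.Theory.
Import numFieldNormedType.Exports.

Local Open Scope classical_set_scope.
Local Open Scope ring_scope.

(* A Z/2-space is given by the (continuous, involutive) action of the
   generator. *)
Record z2space := Z2Space {
  z2car :> topologicalType;
  z2act : z2car -> z2car;
  z2actK : involutive z2act;
  z2act_cts : continuous z2act
}.

Definition equivariant (X Y : z2space) (f : X -> Y) : Prop :=
  forall x, f (z2act x) = z2act (f x).

(* A topological space obtained as a subset A of T (with the subspace
   topology), on which the involution g of T acts. *)
Section RestrictedAction.
Context (T : topologicalType) (A : set T) (g : T -> T).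
Hypotheses (gK : involutive g) (gc : continuous g).
Hypothesis gA : forall x, A x -> A (g x).

Definition restr_act (x : A) : A :=
  exist _ (g (\val x)) (mem_set (gA (set_mem (valP x)))).

Lemma restr_actK : involutive restr_act.
Proof. by move=> x; apply/val_inj; rewrite /= gK. Qed.

Lemma restr_act_cts : continuous restr_act.
Proof.
apply: continuous_comp_initial => x; rewrite /comp /=.
apply: (@continuous_comp A T T set_val g); first exact: initial_continuous.
exact: gc.
Qed.

Definition restr_z2space : z2space := Z2Space restr_actK restr_act_cts.
End RestrictedAction.

(* unit_sphere R n is the sphere S^(n-1); in particular it is empty for
   n = 0. *)
Section Sphere.
Context (R : realType) (n : nat).

Definition unit_sphere : set 'rV[R]_n :=
  [set x : 'rV[R]_n | \sum_i x ord0 i ^+ 2 = 1].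

Lemma unit_sphereN x : unit_sphere x -> unit_sphere (- x).
Proof.
by rewrite /unit_sphere /= => <-; apply: eq_bigr => i _; rewrite mxE sqrrN.
Qed.

Lemma rVN_cts : continuous (-%R : 'rV[R]_n -> 'rV[R]_n).
Proof. exact: opp_continuous. Qed.

Definition antipodal_sphere : z2space :=
  restr_z2space (@opprK 'rV[R]_n) rVN_cts unit_sphereN.
End Sphere.

Arguments unit_sphere R n _ : clear implicits.

(* The dimensions k >= -1 of the spheres S^k, placed in R^(k+1), that map
   equivariantly to Y. *)
Definition coind_dims (R : realType) (Y : z2space) : set int :=
  [set k : int | -1 <= k /\
    exists f : antipodal_sphere R `|(k + 1)%R|%N -> Y,
      continuous f /\ equivariant f].

(* coind Y = k. This is a relation because the largest dimension need not
   exist. *)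
Definition is_coind (R : realType) (Y : z2space) (k : int) : Prop :=
  coind_dims R Y k /\ ubound (coind_dims R Y) k.

Record simplicial_complex (n : nat) := SimplicialComplex {
  faces :> {set {set 'I_n}};
  faces_down : forall s t : {set 'I_n},
    s \in faces -> t \subset s -> t \in faces
}.

Section SimplexBoundary.
Context (m : nat).

Definition proper_faces : {set {set 'I_m.+1}} :=
  [set s : {set 'I_m.+1} | (s \proper [set: 'I_m.+1]%SET)%B].

Lemma proper_faces_down (s t : {set 'I_m.+1}) :
  s \in proper_faces -> t \subset s -> t \in proper_faces.
Proof. by rewrite !inE => + ts; exact: sub_proper_trans. Qed.

Definition simplex_boundary : simplicial_complex m.+1 :=
  SimplicialComplex proper_faces_down.
End SimplexBoundary.

Section AlmostEmbeddings.
Context (R : realType) (n : nat) (K : simplicial_complex n) (d : nat).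

(* Barycentric coordinates: the vertices are the standard basis of R^n. *)
Definition realization : set 'rV[R]_n :=
  [set x : 'rV[R]_n |
           [/\ forall i, 0 <= x ord0 i,
               \sum_i x ord0 i = 1
             & [set i | x ord0 i != 0]%SET \in faces K]].

Definition face_realization (s : {set 'I_n}) : set realization :=
  [set x : realization | forall i, (\val x : 'rV[R]_n) ord0 i != 0 -> i \in s].

Definition almost_embedding (f : realization -> 'rV[R]_d) : Prop :=
  forall s t : {set 'I_n}, s \in faces K -> t \in faces K -> [disjoint s & t]%B ->
    f @` face_realization s `&` f @` face_realization t = set0.

Definition cts_opp (f : continuousType realization 'rV[R]_d) :
    continuousType realization 'rV[R]_d :=
  mkcts (fun x => continuous_comp (@cts_fun _ _ f x) (@rVN_cts R d (f x))).

Lemma cts_oppE f x : cts_opp f x = - f x.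
Proof. by []. Qed.

Lemma cts_oppK : involutive cts_opp.
Proof. by move=> f; apply/continuousEP => x; rewrite !cts_oppE opprK. Qed.

(* This import equips continuousType with the compact-open topology. *)
Import ArrowAsCompactOpen.

Lemma cts_opp_cts : continuous cts_opp.
Proof.
apply: continuous_comp_initial => f.
apply/compact_open_cvgP => [|A O cA oO fAO].
  by apply: fmap_filter; exact: nbhs_filter.
pose O' := -%R @^-1` O : set 'rV[R]_d.
have oO' : open O' by move/continuousP: (@rVN_cts R d); exact.
have fAO' : [set g : realization -> 'rV[R]_d | g @` A `<=` O'] f.
  by move=> _ [a Aa <-]; apply: fAO; exists a.
have nO' : nbhs (f : {compact-open, realization -> 'rV[R]_d})
    [set g : realization -> 'rV[R]_d | g @` A `<=` O'].
  by apply: open_nbhs_nbhs; split => //; exact: compact_open_open.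
have nO : nbhs f [set g : continuousType realization 'rV[R]_d |
    g @` A `<=` O'].
  exact: (@initial_continuous (continuousType realization 'rV[R]_d)
    {compact-open, realization -> 'rV[R]_d} id f _ nO').
apply: filterS nO => g gA _ [a Aa <-].
by apply: (gA (g a)); exists a.
Qed.

Definition AEmb : set (continuousType realization 'rV[R]_d) :=
  [set f : continuousType realization 'rV[R]_d | almost_embedding f].

Lemma AEmbN f : AEmb f -> AEmb (cts_opp f).
Proof.
move=> fA s t sK tK st; rewrite -subset0 => y [[a sa <-] [b tb]].
rewrite !cts_oppE => /oppr_inj fba; have := fA s t sK tK st.
by rewrite -subset0 => /(_ (f a)); apply; split; [exists a|exists b].
Qed.

Definition AEmb_z2 : z2space := restr_z2space cts_oppK cts_opp_cts AEmbN.

End AlmostEmbeddings.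

Arguments realization R {n} K _.
Arguments face_realization R {n} K s _.
Arguments AEmb R {n} K d _.

Definition binary_digit (n i : nat) : bool := odd (n %/ 2 ^ i).

Definition share_binary_one (m n : nat) : Prop :=
  exists i, binary_digit m i && binary_digit n i.

(* Main.v *)
Require Import Defs.
From mathcomp Require Import all_boot all_order all_algebra.
From mathcomp Require Import all_classical all_reals all_analysis.
From mathcomp Require Import zify ring.

(** Lower bound: identify [R^m], [R^(p+1)] and [R^(m+p)] with spaces of polynomials
    of bounded degree, where [m = d - p]. Multiplication by a nonzero polynomial [v]
    is injective, so restricting it to a copy of the boundary of the simplex in
    [R^(p+1)] gives an embedding that depends continuously and oddly on [v].

    Upper bound: an equivariant map [v |-> f_v] from [S^m] yields the map
    [(v, u) |-> f_v (u^+ / |u^+|) - f_v (u^- / |u^-|)] from [S^m * S^p] to [R^(m+p)],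
    where [S^p] consists of the directions [u] with zero coordinate sum. It has no
    zero, because the supports of [u^+] and [u^-] are disjoint, and it is odd in each
    variable. Such a map does not exist when ['C(m + p, p)] is odd: on a fine cubical
    subdivision of [S^m * S^p], the cup product of the sign-change cochains of the
    [m + p] coordinates, evaluated on products of hemispheres, satisfies Pascal's rule
    modulo 2. Hence it is nonzero on some small simplex, on which all the coordinates
    change sign; in the limit this gives a zero. *)

Set Implicit Arguments.
Unset Strict Implicit.
Unset Printing Implicit Defensive.

Import Order.TTheory GRing.Theory Num.Theory.
Import numFieldNormedType.Exports.

Local Open Scope classical_set_scope.
Local Open Scope ring_scope.

(** * Binomial coefficients modulo 2 *)

(** Lucas's theorem modulo 2 for an even upper index. The two parities of the lower index are proved
    together because Pascal's rule, applied twice, mixes them. *)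
Lemma odd_bin_double n k :
  odd 'C(n.*2, k.*2) = odd 'C(n, k) /\ odd 'C(n.*2, k.*2.+1) = false.
Proof.
elim: n k => [|n IH] [|k] //; rewrite ?bin0n //= !doubleS !binS !oddD ?bin0 /=.
  by rewrite !bin1 odd_double.
have [h1 h2] := IH k; have [h3 h4] := IH k.+1.
by rewrite doubleS in h3 h4; rewrite h1 h2 h3 h4; do 2!case: odd.
Qed.

(** One step of Lucas's theorem: the factor contributed by the last binary digits vanishes only when
    [k] is odd and [n] is even. *)
Lemma odd_bin_half n k :
  odd 'C(n, k) = odd 'C(n./2, k./2) && (odd k ==> odd n).
Proof.
rewrite -{1}(odd_double_half n) -{1}(odd_double_half k).
have [h1 h2] := odd_bin_double n./2 k./2.
case: (odd n); case: (odd k); rewrite ?add1n ?add0n ?andbT ?andbF //.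
  by rewrite binS oddD h1 h2.
case: (k./2) h1 h2 => [|j] h1 h2; first by rewrite !bin0.
have [h3 h4] := odd_bin_double n./2 j.
by rewrite doubleS binS oddD -doubleS h1 h4 addbF.
Qed.

Lemma no_shared_binary_one_odd_bin a b : ~ share_binary_one a b -> odd 'C(a + b, a).
Proof.
elim/ltn_ind: a b => a IH b nab.
have [->|a0] := posnP a; first by rewrite bin0.
have nh : ~ share_binary_one a./2 b./2.
  case=> i; rewrite /binary_digit => hi; apply: nab; exists i.+1.
  by move: hi; rewrite /binary_digit expnS !divnMA !divn2.
have := nab; rewrite odd_bin_half => {}nab.
have oab : ~~ (odd a && odd b).
  by apply/negP => h; apply: nab; exists 0%N; rewrite /binary_digit !divn1.
(* There is no carry out of the last digit, so halving the sum removes one digit from each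
   summand. *)
have -> : (a + b)./2 = (a./2 + b./2)%N.
  by rewrite halfD (negbTE oab) add0n.
rewrite IH //=; last by rewrite -divn2 ltn_Pdiv.
by rewrite oddD; move: oab; case: (odd a); case: (odd b).
Qed.

(** * Cochains modulo 2 *)

Local Notation "\xor_ ( i <- r ) F" := (\big[addb/false]_(i <- r) F)
  (at level 41, F at level 41, i, r at level 50).

(* Deleting the only vertex counts, as in the augmented complex. *)
Fixpoint coboundary T (phi : seq T -> bool) (l : seq T) : bool :=
  if l is v :: l' then phi l' (+) coboundary (phi \o cons v) l' else false.

Section Flags.
Context (T : eqType) (bd : T -> seq T).
Implicit Types (c : T) (phi : seq T -> bool).

(* The sum of [phi] over the flags [c = c_0, c_1, ..., c_k] of successive boundary
   cells, i.e. over the [k]-simplices of the barycentric subdivision of [c]. *)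
Fixpoint flag_sum (k : nat) phi c : bool :=
  if k is k'.+1 then \xor_(x <- bd c) flag_sum k' (phi \o cons c) x
  else phi [:: c].

(** Relative to a predicate closed under [bd], since the sign cochains used later are odd only on
    cells of the cube boundaries. *)
Lemma eq_flag_sum_in (P : pred T) k phi psi c :
    (forall b x, P b -> x \in bd b -> P x) ->
    (forall l, all P l -> phi l = psi l) ->
  P c -> flag_sum k phi c = flag_sum k psi c.
Proof.
move=> Pbd; elim: k phi psi c => [|k IH] phi psi c e Pc /=.
  by apply: e; rewrite /= Pc.
rewrite big_seq [RHS]big_seq; apply: eq_bigr => x xc.
by apply: IH (Pbd _ _ Pc xc) => l Pl /=; apply: e; rewrite /= Pc.
Qed.

Lemma eq_flag_sum k phi psi c : phi =1 psi -> flag_sum k phi c = flag_sum k psi c.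
Proof. by move=> e; apply: (@eq_flag_sum_in predT). Qed.

Lemma flag_sumD k phi psi c :
  flag_sum k (fun l => phi l (+) psi l) c = flag_sum k phi c (+) flag_sum k psi c.
Proof.
elim: k phi psi c => [//|k IH] phi psi c /=.
rewrite -big_split; apply: eq_bigr => x _.
exact: (IH (phi \o cons c) (psi \o cons c)).
Qed.

Lemma flag_sum_witness k phi c : flag_sum k phi c ->
  exists l, [/\ size l = k, path (fun a b => b \in bd a) c l & phi (c :: l)].
Proof.
elim: k phi c => [|k IH] phi c /=; first by exists [::].
move=> h; have /hasP[x xc /IH[l [ls lp hl]]] :
    has (flag_sum k (phi \o cons c)) (bd c).
  apply: contraTT h => /hasPn h; rewrite big_seq big1 // => x /h.
  by case: flag_sum.
by exists (x :: l); rewrite /= ls xc.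
Qed.

Hypothesis bdbd : forall c (f : T -> bool), \xor_(x <- bd c) \xor_(y <- bd x) f y = false.
Hypothesis bd_even : forall c, \xor_(x <- bd c) true = false.

(** Stokes' formula for the barycentric subdivision. Deleting [c] from a flag leaves a flag of a
    boundary cell. The deletions of an intermediate cell cancel by [bdbd], and those of the last
    cell by [bd_even]. *)
Lemma flag_sum_coboundary k phi c :
  flag_sum k.+1 (coboundary phi) c = \xor_(x <- bd c) flag_sum k phi x.
Proof.
have step j psi b : flag_sum j.+1 (coboundary psi) b = \xor_(x <- bd b)
    (flag_sum j psi x (+) flag_sum j (coboundary (psi \o cons b)) x).
  by apply: eq_bigr => x _; rewrite -flag_sumD.
elim: k phi c => [|k IH] phi c; rewrite step.
- rewrite big_split /= [X in _ (+) X](_ : _ = false) ?addbF //.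
  by case: (phi [:: c]) => //; rewrite big1_eq.
- rewrite (eq_bigr _ (fun x _ => congr1 (addb _) (IH (phi \o cons c) x))).
  by rewrite big_split bdbd /= addbF.
Qed.
End Flags.

(** * Cup products of sign cochains *)

Section CupProduct.
Context (T : eqType) (sg : nat -> T -> bool).

(* The cup product of the coboundaries of the 0-cochains [sg i], [sg i.+1], ...;
   in [cup_last] the last factor is the 0-cochain itself. *)
Fixpoint cup (i : nat) (l : seq T) : bool :=
  if l is u :: l' then
    if l' is v :: _ then (sg i u (+) sg i v) && cup i.+1 l' else true
  else false.

Fixpoint cup_last (i : nat) (l : seq T) : bool :=
  if l is u :: l' then
    if l' is v :: _ then (sg i u (+) sg i v) && cup_last i.+1 l' else sg i u
  else true.

(** Leibniz rule: all factors but the last are coboundaries, hence cocycles, so only the last factor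
    is differentiated. The value [true] of [cup_last] on the empty list matches the augmented
    convention of [coboundary]. *)
Lemma coboundary_cup_last i l : coboundary (cup_last i) l = cup i l.
Proof.
elim: l i => [//|u [//|v l] IH] i.
(* A factor that depends only on the first two vertices comes out of the coboundary in the remaining
   ones. *)
have cE (b : bool) (phi psi : seq T -> bool) s :
    (forall s, phi s = b && psi s) -> coboundary phi s = b && coboundary psi s.
  elim: s phi psi => [|x s IHs] phi psi e /=; first by rewrite andbF.
  by rewrite e (IHs _ (psi \o cons x)) ?andb_addr // => t; rewrite /= e.
case: l IH => [_|x l /(_ i.+1) IH].
  by rewrite /=; case: (sg i u); case: (sg i v).
rewrite -[LHS]/(cup_last i (v :: x :: l) (+) (cup_last i (u :: x :: l) (+)
  coboundary (cup_last i \o cons u \o cons v) (x :: l))).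
rewrite (cE (sg i u (+) sg i v) _ (cup_last i.+1 \o cons v)) //.
rewrite -[RHS]/((sg i u (+) sg i v) && cup i.+1 (v :: x :: l)) -IH.
rewrite -[coboundary _ (v :: _)]/(cup_last i.+1 (x :: l) (+)
  coboundary (cup_last i.+1 \o cons v) (x :: l)).
rewrite -[cup_last i (v :: _)]/((sg i v (+) sg i x) && cup_last i.+1 (x :: l)).
rewrite -[cup_last i (u :: _)]/((sg i u (+) sg i x) && cup_last i.+1 (x :: l)).
move: (coboundary _ _) (cup_last _ _) => [] [];
by case: (sg i u); case: (sg i v); case: (sg i x).
Qed.

(** Negating every sign preserves the differences and flips only the last factor, which adds the
    product of the differences. *)
Lemma cup_last_antipode (P : pred T) (s : T -> T) i l :
    (forall j x, P x -> sg j (s x) = ~~ sg j x) -> all P l ->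
  cup_last i (map s l) = cup_last i l (+) cup i l.
Proof.
move=> sgs; elim: l i => [//|u [|v l] IH] i; rewrite [all _ _]/= => /andP[Pu Pl].
  by rewrite /= sgs // addbT.
rewrite -[LHS]/((sg i (s u) (+) sg i (s v)) && cup_last i.+1 (map s (v :: l))).
rewrite IH // !sgs //; last by case/andP: Pl.
rewrite -[cup_last i _]/((sg i u (+) sg i v) && cup_last i.+1 (v :: l)).
rewrite -[cup i _]/((sg i u (+) sg i v) && cup i.+1 (v :: l)).
by rewrite -andb_addr addNb addbN negbK.
Qed.

Lemma cup_sign_change i l j : cup i l -> (j < (size l).-1)%N ->
  exists u v, [/\ u \in l, v \in l & sg (i + j)%N u != sg (i + j)%N v].
Proof.
elim: l i j => [//|u [|v l] IH] i j //= /andP[uv cl].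
case: j => [_|j lj].
  exists u, v; rewrite !inE !eqxx orbT addn0; split => //.
  by move: uv; case: (sg i u); case: (sg i v).
have [a [b [al bl ab]]] := IH i.+1 j cl lj.
by exists a, b; rewrite addnS -addSn inE al orbT inE bl orbT.
Qed.
End CupProduct.

(** * Cubical hemispheres *)

Section Grid.
Implicit Types (c : seq int).

(* A cell of the cubical grid is coded by its centre, the vertices having even
   coordinates: an odd entry [x] is the interval [[x - 1, x + 1]], an even one a point. *)
Fixpoint cell_bd c : seq (seq int) :=
  if c is x :: c' then
    (if odd `|x|%N then [:: x - 1 :: c'; x + 1 :: c'] else [::])
      ++ [seq x :: y | y <- cell_bd c']
  else [::].

Lemma odd_abszB1 (x : int) : odd `|(x - 1)%R|%N = ~~ odd `|x|%N.
Proof. by case: x => [[|n]|n] //=; rewrite ?subn1 ?addn1 ?addn0 //= negbK. Qed.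

Lemma odd_abszD1 (x : int) : odd `|(x + 1)%R|%N = ~~ odd `|x|%N.
Proof. by rewrite -[in RHS](addrK 1 x) odd_abszB1 negbK. Qed.

Lemma cell_bdbd c (f : seq int -> bool) :
  \xor_(x <- cell_bd c) \xor_(y <- cell_bd x) f y = false.
Proof.
elim: c f => [|x c IH] f /=; first by rewrite big_nil.
rewrite big_cat big_map /=.
have -> : \xor_(y <- cell_bd c) \xor_(z <- cell_bd (x :: y)) f z =
  if odd `|x|%N then \xor_(y <- cell_bd c) (f (x - 1 :: y) (+) f (x + 1 :: y))
  else false.
  transitivity (\xor_(y <- cell_bd c)
    ((if odd `|x|%N then f (x - 1 :: y) (+) f (x + 1 :: y) else false) (+)
     \xor_(z <- cell_bd y) f (x :: z))).
    apply: eq_bigr => y _; rewrite /= big_cat big_map /=.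
    by case: ifP; rewrite !(big_cons, big_nil) ?addbF.
  by rewrite big_split /= (IH (f \o cons x)) addbF; case: ifP; rewrite ?big1_eq.
case: ifP => ox; rewrite !(big_cons, big_nil) //=.
by rewrite odd_abszB1 odd_abszD1 ox /= !big_map big_split /= addbF addbb.
Qed.

Lemma cell_bd_even c : \xor_(x <- cell_bd c) true = false.
Proof.
elim: c => [|x c IH] /=; first by rewrite big_nil.
by rewrite big_cat big_map /= IH; case: ifP; rewrite !(big_cons, big_nil).
Qed.

Lemma cell_bd_pad k c : cell_bd (nseq k 0 ++ c) = [seq nseq k 0 ++ x | x <- cell_bd c].
Proof. by elim: k => [|k IH] /=; rewrite ?map_id // IH -map_comp. Qed.

Lemma cell_bd_opp c (f : seq int -> bool) :
  \xor_(x <- cell_bd (map -%R c)) f x = \xor_(x <- cell_bd c) f (map -%R x).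
Proof.
elim: c f => [|x c IH] f /=; first by rewrite !big_nil.
rewrite !big_cat !big_map /= (IH (f \o cons (- x))) abszN; congr (_ (+) _).
case: ifP => _; rewrite !(big_cons, big_nil) //= !addbF addbC opprB opprD.
by rewrite [1 - x]addrC.
Qed.

(** Centres of the [N] intervals of length 2 that subdivide [[0, 2N]]; [line] does the same for
    [[-2N, 2N]]. *)
Definition half_line (N : nat) : seq int := [seq (k.*2.+1)%:Z | k <- iota 0 N].
Definition line N := half_line N ++ map -%R (half_line N).

Fixpoint cube_cells N n : seq (seq int) :=
  if n is n'.+1 then [seq x :: c | x <- line N, c <- cube_cells N n'] else [:: [::]].

(* [sphere_cells N n] is a hemisphere of the boundary of [[-2N, 2N]^n]; its
   boundary is the equator, made of [sphere_cells N n.-1] and its antipode. *)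
Fixpoint sphere_cells N n : seq (seq int) :=
  if n is n'.+1 then
    [seq N.*2%:Z :: c | c <- cube_cells N n'] ++
    [seq x :: c | x <- half_line N,
        c <- sphere_cells N n' ++ map (map -%R) (sphere_cells N n')]
  else [::].

Lemma sphere_cells1 N : sphere_cells N 1 = [:: [:: N.*2%:Z]].
Proof.
rewrite -[LHS]/(_ :: [seq x :: c | x <- half_line N, c <- [::]]); congr (_ :: _).
by elim: (half_line N).
Qed.

Lemma half_line_odd N x : x \in half_line N -> odd `|x|%N.
Proof. by case/mapP => k _ ->; rewrite /= odd_double. Qed.

Lemma line_odd N x : x \in line N -> odd `|x|%N.
Proof.
rewrite mem_cat => /orP[/half_line_odd //|/mapP[y /half_line_odd oy ->]].
by rewrite abszN.
Qed.

Lemma half_line_bd N (f : int -> bool) :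
  \xor_(x <- half_line N) (f (x - 1) (+) f (x + 1)) = f 0 (+) f N.*2%:Z.
Proof.
elim: N => [|N IH]; first by rewrite big_nil addbb.
rewrite /half_line -addn1 iotaD map_cat big_cat /= IH big_seq1 add0n.
have -> : (N.*2.+1)%:Z - 1 = N.*2%:Z by rewrite -addn1 PoszD addrK.
have -> : (N.*2.+1)%:Z + 1 = (N + 1).*2%:Z by rewrite addn1 doubleS -PoszD addn1.
by rewrite addbA addbK.
Qed.

Lemma line_bd N (f : int -> bool) :
  \xor_(x <- line N) (f (x - 1) (+) f (x + 1)) = f (- N.*2%:Z) (+) f N.*2%:Z.
Proof.
rewrite big_cat half_line_bd big_map /=.
rewrite [X in _ (+) X](_ : _ = f 0 (+) f (- N.*2%:Z)).
  by case: (f 0); case: (f N.*2%:Z); case: (f (- N.*2%:Z)).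
rewrite -[f 0]/((f \o -%R) 0) -[RHS](half_line_bd N (f \o -%R)).
by apply: eq_bigr => x _; rewrite /= addbC opprB opprD [1 - x]addrC.
Qed.

Lemma line_opp N (f : int -> bool) : \xor_(x <- line N) f (- x) = \xor_(x <- line N) f x.
Proof.
by rewrite !big_cat !big_map /= addbC; congr (_ (+) _).
Qed.

Lemma cell_bd_prod (l : seq int) (C : seq (seq int)) (f : seq int -> bool) :
    {in l, forall x, odd `|x|%N} ->
  \xor_(c <- [seq x :: c | x <- l, c <- C]) \xor_(y <- cell_bd c) f y =
  \xor_(c <- C) \xor_(x <- l) (f (x - 1 :: c) (+) f (x + 1 :: c)) (+)
  \xor_(x <- l) \xor_(c <- C) \xor_(y <- cell_bd c) f (x :: y).
Proof.
move=> ol; rewrite big_allpairs_dep exchange_big /= [X in _ (+) X]exchange_big.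
rewrite -big_split /=; apply: eq_bigr => c _; rewrite -big_split /=.
rewrite big_seq [RHS]big_seq; apply: eq_bigr => x /ol ->.
by rewrite big_cat big_map !(big_cons, big_nil) /= addbF.
Qed.

Lemma cube_cells_opp N n (f : seq int -> bool) :
  \xor_(c <- cube_cells N n) f (map -%R c) = \xor_(c <- cube_cells N n) f c.
Proof.
elim: n f => [|n IH] f /=; first by rewrite !big_seq1.
rewrite !big_allpairs_dep /= -[RHS]line_opp; apply: eq_bigr => x _.
exact: (IH (f \o cons (- x))).
Qed.

Lemma map_oppK c : map -%R (map -%R c) = c.
Proof. by rewrite mapK //; exact: opprK. Qed.

(** Inner facets cancel. Those transverse to the first axis telescope to the two end faces, which
    are antipodal to each other. In the other directions the induction applies in every slice, and
    the slices at [x] and [- x] are paired. *)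
Lemma cube_cells_bd N n (f : seq int -> bool) :
  \xor_(c <- cube_cells N n) \xor_(y <- cell_bd c) f y =
  \xor_(c <- sphere_cells N n) (f c (+) f (map -%R c)).
Proof.
elim: n f => [|n IH] f; first by rewrite /= big_seq1 !big_nil.
rewrite [cube_cells _ _]/= cell_bd_prod; last exact: line_odd.
rewrite [sphere_cells _ _]/= [RHS]big_cat [in RHS]big_map /=; congr (_ (+) _).
  rewrite (eq_bigr _ (fun c _ => line_bd N (fun x => f (x :: c)))) !big_split /=.
  by rewrite addbC (cube_cells_opp _ _ (f \o cons _)).
rewrite big_allpairs_dep [LHS]big_cat [X in _ (+) X = _]big_map -big_split /=.
apply: eq_bigr => x _.
rewrite (IH (f \o cons x)) (IH (f \o cons (- x))).
rewrite big_cat big_map /= -!big_split; apply: eq_bigr => c _ /=.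
rewrite map_oppK; move: (f _) (f _) (f _) (f _) => [] [] [] [] //.
Qed.

(** A hemisphere is a cap at height [2N] together with the product of [[0, 2N]] and a sphere of one
    dimension less. The rim of the cap cancels the top of this cylinder, and its bottom, the equator
    at height 0, remains. *)
Lemma sphere_cells_bd N n (f : seq int -> bool) :
  \xor_(c <- sphere_cells N n.+1) \xor_(y <- cell_bd c) f y =
  \xor_(c <- sphere_cells N n) (f (0 :: c) (+) f (0 :: map -%R c)).
Proof.
elim: n f => [|n IH] f.
  by rewrite sphere_cells1 big_seq1 /= odd_double !big_nil.
rewrite -[sphere_cells N n.+2]/([seq N.*2%:Z :: c | c <- cube_cells N n.+1] ++
  [seq x :: c | x <- half_line N,
        c <- sphere_cells N n.+1 ++ map (map -%R) (sphere_cells N n.+1)]).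
have := cube_cells_bd N n.+1.
move: (cube_cells _ _) (sphere_cells N n.+1) IH => D S IH cubeS.
(* The lower sphere is a cycle: its two hemispheres have the same boundary, which by induction is
   invariant under the antipode. *)
have tail x : \xor_(c <- S ++ map (map -%R) S) \xor_(y <- cell_bd c) f (x :: y) = false.
  rewrite big_cat big_map /= (eq_bigr _ (fun c _ => cell_bd_opp c (f \o cons x))).
  rewrite -big_split (eq_bigr (fun c => \xor_(y <- cell_bd c)
    (f (x :: y) (+) f (x :: map -%R y)))) => [|c _]; last by rewrite -big_split.
  rewrite (IH (fun y => f (x :: y) (+) f (x :: map -%R y))) big1 // => c _.
  by rewrite /= map_oppK oppr0; case: (f _); case: (f _).
rewrite big_cat big_map cell_bd_prod; last exact: half_line_odd.
rewrite [X in _ (+) X]big1 => [|x _]; last exact: tail.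
rewrite (eq_bigr _ (fun c _ => half_line_bd N (fun x => f (x :: c)))) /= addbF.
rewrite [X in X (+) _ = _](_ : _ = \xor_(c <- S)
  (f (N.*2%:Z :: c) (+) f (N.*2%:Z :: map -%R c))); last first.
  rewrite -(cubeS (f \o cons _)); apply: eq_bigr => c _.
  by rewrite /= odd_double big_map.
rewrite big_cat big_map /= -!big_split; apply: eq_bigr => c _ /=.
by case: (f (0 :: c)); case: (f (0 :: map -%R c)); case: (f (_ :: c)); case: (f _).
Qed.

(** Leading zeros put the hemispheres of all dimensions into one grid in dimension [q], nested as
    successive equators. *)
Definition padded_sphere_cells N q n : seq (seq int) :=
  [seq nseq (q - n) 0 ++ c | c <- sphere_cells N n].

Lemma padded_sphere_cells_bd N q n (f : seq int -> bool) : (n <= q)%N ->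
  \xor_(c <- padded_sphere_cells N q n) \xor_(y <- cell_bd c) f y =
  \xor_(c <- padded_sphere_cells N q n.-1) (f c (+) f (map -%R c)).
Proof.
case: n => [|n] nq; first by rewrite !big_nil.
rewrite !big_map; under eq_bigr do rewrite cell_bd_pad big_map.
rewrite (sphere_cells_bd _ _ (fun y => f (_ ++ y))); apply: eq_bigr => c _.
have padE y : nseq (q - n.+1) 0 ++ 0 :: y = nseq (q - n) (0 : int) ++ y.
  by rewrite -(subnSK nq); elim: (q - n.+1)%N => //= k ->.
by rewrite !padE map_cat map_nseq oppr0.
Qed.

(** This invariant of flags keeps the centres at maximum norm at least [2N], so that they can be
    projected radially. *)
Definition on_cube_boundary N q c := (size c == q) && has (fun x => `|x|%N == N.*2) c.

Lemma on_cube_boundary_opp N q c :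
  on_cube_boundary N q (map -%R c) = on_cube_boundary N q c.
Proof.
rewrite /on_cube_boundary size_map has_map; congr (_ && _).
by apply: eq_has => x /=; rewrite abszN.
Qed.

Lemma cell_bd_near c x : x \in cell_bd c ->
  size x = size c /\ forall k, `|x`_k - c`_k| <= 1.
Proof.
elim: c x => [|y c IH] x //=; rewrite mem_cat => /orP[|/mapP[z /IH[sz zc] ->]]; last first.
  by split=> [|[|k]]; rewrite /= ?sz // subrr normr0.
case: ifP => // _; rewrite !inE => /orP[] /eqP -> /=; split => // -[|k] /=;
  by rewrite ?subrr ?normr0 // addrC addKr ?normrN normr1.
Qed.

(** An entry of absolute value [2N] is even, so [cell_bd] never changes it. *)
Lemma on_cube_boundary_bd N q c x :
  on_cube_boundary N q c -> x \in cell_bd c -> on_cube_boundary N q x.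
Proof.
case/andP=> sc h xc; rewrite /on_cube_boundary (cell_bd_near xc).1 sc /=.
elim: c x h {sc} xc => [|y c IH] x //=; rewrite mem_cat => h /orP[|/mapP[z zc ->] /=].
  case: ifP h => [oy h|//]; rewrite !inE => /orP[] /eqP -> /=; apply/orP; right;
  by case/orP: h => // /eqP e; rewrite e odd_double in oy.
by case/orP: h => [->//|h]; rewrite IH ?orbT.
Qed.

Lemma size_cube_cells N n : {in cube_cells N n, forall c, size c = n}.
Proof.
elim: n => [|n IH] c; first by rewrite inE => /eqP ->.
by case/allpairsP => [[x d] [_ /IH /= <- ->]].
Qed.

Lemma sphere_cells_on_cube_boundary N n :
  {in sphere_cells N n, forall c, on_cube_boundary N n c}.
Proof.
elim: n => [//|n IH] c; rewrite mem_cat => /orP[/mapP[d /size_cube_cells sd ->]|].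
  by rewrite /on_cube_boundary /= eqxx sd eqxx.
have h d : d \in sphere_cells N n ++ map (map -%R) (sphere_cells N n) ->
    on_cube_boundary N n d.
  rewrite mem_cat => /orP[/IH //|/mapP[e /IH he ->]].
  by rewrite on_cube_boundary_opp.
case/allpairsP => [[x d] [_ /= /h /andP[sd hd] ->]].
by rewrite /on_cube_boundary /= eqSS sd hd orbT.
Qed.

Lemma padded_sphere_cells_on_cube_boundary N q n : (n <= q)%N ->
  {in padded_sphere_cells N q n, forall c, on_cube_boundary N q c}.
Proof.
move=> nq _ /mapP[c /sphere_cells_on_cube_boundary /andP[/eqP sc hc] ->].
by rewrite /on_cube_boundary size_cat size_nseq sc subnK // eqxx has_cat hc orbT.
Qed.
End Grid.

(** * Products of hemispheres and Pascal's rule *)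

Section CellProduct.
Local Notation T := (seq int * seq int)%type.
Implicit Types (z : T).

Definition prod_bd z : seq T :=
  [seq (x, z.2) | x <- cell_bd z.1] ++ [seq (z.1, y) | y <- cell_bd z.2].

Lemma big_prod_bd z (f : T -> bool) : \xor_(x <- prod_bd z) f x =
  \xor_(x <- cell_bd z.1) f (x, z.2) (+) \xor_(y <- cell_bd z.2) f (z.1, y).
Proof. by rewrite big_cat !big_map. Qed.

Lemma prod_bdbd z (f : T -> bool) :
  \xor_(x <- prod_bd z) \xor_(y <- prod_bd x) f y = false.
Proof.
rewrite big_prod_bd.
under eq_bigr do rewrite big_prod_bd; under [X in _ (+) X]eq_bigr do rewrite big_prod_bd.
rewrite !big_split /= (cell_bdbd _ (fun x => f (x, z.2))).
rewrite (cell_bdbd _ (fun y => f (z.1, y))).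
by rewrite exchange_big addbF addbb.
Qed.

Lemma prod_bd_even z : \xor_(x <- prod_bd z) true = false.
Proof. by rewrite big_prod_bd !cell_bd_even. Qed.

Definition opp1 z : T := (map -%R z.1, z.2).
Definition opp2 z : T := (z.1, map -%R z.2).

Lemma flag_sum_opp1 k phi z :
  flag_sum prod_bd k phi (opp1 z) = flag_sum prod_bd k (phi \o map opp1) z.
Proof.
elim: k phi z => [//|k IH] phi z; rewrite /= !big_prod_bd /=.
rewrite (cell_bd_opp _ (fun x => flag_sum _ _ _ (x, _))); congr (_ (+) _);
apply: eq_bigr => x _.
  exact: (IH (phi \o cons (opp1 z)) (x, z.2)).
exact: (IH (phi \o cons (opp1 z)) (z.1, x)).
Qed.

Lemma flag_sum_opp2 k phi z :
  flag_sum prod_bd k phi (opp2 z) = flag_sum prod_bd k (phi \o map opp2) z.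
Proof.
elim: k phi z => [//|k IH] phi z; rewrite /= !big_prod_bd /=.
rewrite (cell_bd_opp _ (fun x => flag_sum _ _ _ (_, x))); congr (_ (+) _);
apply: eq_bigr => x _.
  exact: (IH (phi \o cons (opp2 z)) (x, z.2)).
exact: (IH (phi \o cons (opp2 z)) (z.1, x)).
Qed.

Context (sg : nat -> T -> bool) (N q r : nat).
Let good z := on_cube_boundary N q z.1 && on_cube_boundary N r z.2.
Hypothesis sg1 : forall i z, good z -> sg i (opp1 z) = ~~ sg i z.
Hypothesis sg2 : forall i z, good z -> sg i (opp2 z) = ~~ sg i z.

Lemma good_bd z x : good z -> x \in prod_bd z -> good x.
Proof.
case/andP=> g1 g2; rewrite mem_cat => /orP[] /mapP[y yz ->];
  rewrite /good /= ?g1 ?g2 ?andbT //.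
  exact: on_cube_boundary_bd yz.
exact: on_cube_boundary_bd yz.
Qed.

(* The hemispheres [i] and [j] have dimensions [i - 1] and [j - 1]; there is no
   hemisphere [0]. *)
Definition cup_count k i j : bool :=
  \xor_(c <- padded_sphere_cells N q i) \xor_(d <- padded_sphere_cells N r j)
    flag_sum prod_bd k (cup sg 0) (c, d).

(** Stokes' formula moves the sum to the boundary of the product, one factor at a time. The boundary
    of a hemisphere is a smaller hemisphere and its antipode, on which the values of [cup_last]
    differ by [cup]; so only [cup] on the smaller hemisphere survives. *)
Lemma cup_countS k i j : (i <= q)%N -> (j <= r)%N ->
  cup_count k.+1 i j = cup_count k i.-1 j (+) cup_count k i j.-1.
Proof.
move=> iq jr; rewrite /cup_count.
have stepE c d : flag_sum prod_bd k.+1 (cup sg 0) (c, d) =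
    \xor_(x <- cell_bd c) flag_sum prod_bd k (cup_last sg 0) (x, d) (+)
    \xor_(y <- cell_bd d) flag_sum prod_bd k (cup_last sg 0) (c, y).
  rewrite -(eq_flag_sum _ _ _ (coboundary_cup_last sg 0)).
  by rewrite flag_sum_coboundary ?big_prod_bd //; [exact: prod_bdbd|exact: prod_bd_even].
under eq_bigr do under eq_bigr do rewrite stepE.
under eq_bigr do rewrite big_split /=.
rewrite big_split /=; congr (_ (+) _).
  rewrite exchange_big [RHS]exchange_big /= big_seq [RHS]big_seq.
  apply: eq_bigr => d dr.
  rewrite (padded_sphere_cells_bd _ (fun x => flag_sum _ _ _ (x, d))) //.
  rewrite big_seq [RHS]big_seq; apply: eq_bigr => c cq.
  have gz : good (c, d).
    rewrite /good (padded_sphere_cells_on_cube_boundary _ cq) ?(leq_trans (leq_pred _)) //.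
    by rewrite (padded_sphere_cells_on_cube_boundary _ dr).
  rewrite -[(map _ c, d)]/(opp1 (c, d)) flag_sum_opp1.
  rewrite [X in _ (+) X](_ : _ = flag_sum prod_bd k
      (fun l => cup_last sg 0 l (+) cup sg 0 l) (c, d)).
    by rewrite flag_sumD addKb.
  by apply: eq_flag_sum_in good_bd _ gz => l gl; apply: cup_last_antipode gl.
rewrite big_seq [RHS]big_seq; apply: eq_bigr => c cq.
rewrite (padded_sphere_cells_bd _ (fun x => flag_sum _ _ _ (c, x))) //.
rewrite big_seq [RHS]big_seq; apply: eq_bigr => d dr.
have gz : good (c, d).
  rewrite /good (padded_sphere_cells_on_cube_boundary _ cq) //.
  by rewrite (padded_sphere_cells_on_cube_boundary _ dr) ?(leq_trans (leq_pred _)).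
rewrite -[(c, map _ d)]/(opp2 (c, d)) flag_sum_opp2.
rewrite [X in _ (+) X](_ : _ = flag_sum prod_bd k
      (fun l => cup_last sg 0 l (+) cup sg 0 l) (c, d)).
  by rewrite flag_sumD addKb.
by apply: eq_flag_sum_in good_bd _ gz => l gl; apply: cup_last_antipode gl.
Qed.

(** The recursion is Pascal's rule. At the apex, a pair of points carries one flag and the empty
    product; along the two sides, one term involves the empty hemisphere 0. *)
Lemma cup_count_odd_bin i j : (i < q)%N -> (j < r)%N ->
  cup_count (i + j) i.+1 j.+1 = odd 'C(i + j, i).
Proof.
have c0 k j' : cup_count k 0 j' = false by rewrite /cup_count big_nil.
have c1 k i' : cup_count k i' 0 = false.
  by rewrite /cup_count big1 // => c _; rewrite big_nil.
elim: i j => [|i IHi]; elim => [|j IHj] iq jr.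
- by rewrite /cup_count /padded_sphere_cells !sphere_cells1 !big_seq1.
- by rewrite addnS cup_countS // c0 -[0%N in LHS]/0%N IHj ?(ltnW jr) // !bin0.
- by rewrite addSn cup_countS // c1 addbF IHi ?(ltnW iq) // addn0 !binn.
- rewrite addSn cup_countS // IHi ?(ltnW iq) // binS oddD addbC; congr (_ (+) _).
  by rewrite addnS -addSn IHj // ltnW.
Qed.

Lemma prod_bd_path_near z l k : path (fun a b => b \in prod_bd a) z l -> {in l, forall u,
  `|u.1`_k - z.1`_k| <= (size l)%:Z /\ `|u.2`_k - z.2`_k| <= (size l)%:Z}.
Proof.
elim: l z => [//|v l IH] z /= /andP[vz vl] u.
have step : `|v.1`_k - z.1`_k| <= 1 /\ `|v.2`_k - z.2`_k| <= 1.
  by move: vz; rewrite mem_cat => /orP[] /mapP[x /cell_bd_near[_ h] ->] /=;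
     rewrite subrr normr0.
rewrite inE -addn1 PoszD => /predU1P[->|/(IH _ vl)[h1 h2]].
  by case: step => s1 s2; split; rewrite -[`|_|]add0r lerD.
case: step => s1 s2.
split; [rewrite -(subrKA v.1`_k)|rewrite -(subrKA v.2`_k)];
  by apply: le_trans (ler_normD _ _) _; rewrite lerD.
Qed.

(** An odd count leaves a flag on which the cup product is nonzero, and then each factor is a sign
    change between consecutive cells. *)
Lemma exists_sign_changing_flag i j :
    (i < q)%N -> (j < r)%N -> odd 'C(i + j, i) ->
  exists z l, [/\ good z, all good l, forall k, {in l, forall u,
    `|u.1`_k - z.1`_k| <= (i + j)%:Z /\ `|u.2`_k - z.2`_k| <= (i + j)%:Z} &
    forall k, (k < i + j)%N -> exists u v,
      [/\ u \in z :: l, v \in z :: l & sg k u != sg k v]].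
Proof.
move=> iq jr; rewrite -cup_count_odd_bin // => h.
have has_xor (T : eqType) (s : seq T) (F : T -> bool) :
    \xor_(x <- s) F x -> exists2 x, x \in s & F x.
  move=> hs; apply/hasP; apply: contraTT hs => /hasPn hs.
  by rewrite big_seq big1 // => x /hs; case: (F x).
have [c cq /has_xor[d dr /flag_sum_witness[l [sl pl cl]]]] := has_xor _ _ _ h.
have gz : good (c, d).
  rewrite /good (padded_sphere_cells_on_cube_boundary _ cq) //.
  by rewrite (padded_sphere_cells_on_cube_boundary _ dr).
exists (c, d), l; split=> //; last 2 first.
- by move=> k; rewrite -sl; apply: prod_bd_path_near.
- by move=> k kij; apply: (cup_sign_change cl); rewrite /= sl.
elim: l (c, d) gz pl {sl cl} => [//|v l IH] z gz /= /andP[vz vl].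
  by rewrite (good_bd gz vz) (IH v) ?(good_bd gz vz).
Qed.
End CellProduct.

(** * Maps of two spheres odd in each variable *)

Section Normalize.
Context {R : realType}.

Lemma le_mx_norm_coord m n (x : 'M[R]_(m, n)) i j : `|x i j| <= `|x|.
Proof.
by rewrite [leRHS]/Num.norm /= mx_normrE; apply/bigmax_geP; right => /=; exists (i, j).
Qed.

Lemma mx_norm_le_coord m n (x : 'M[R]_(m, n)) (e : R) :
  0 <= e -> (forall i j, `|x i j| <= e) -> `|x| <= e.
Proof.
move=> e0 h; rewrite [leLHS]/Num.norm /= mx_normrE.
by apply/bigmax_leP; split => // -[i j] _; exact: h.
Qed.

Definition normalize (V : normedModType R) (x : V) : V := `|x|^-1 *: x.

Lemma norm_normalize (V : normedModType R) (x : V) : x != 0 -> `|normalize x| = 1.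
Proof.
by move=> x0; rewrite normrZ normfV normr_id mulVf // normr_eq0.
Qed.

Lemma normalizeN (V : normedModType R) (x : V) : normalize (- x) = - normalize x.
Proof. by rewrite /normalize normrN scalerN. Qed.

Lemma normalize_lipschitz (V : normedModType R) (x y : V) :
  x != 0 -> y != 0 -> `|normalize x - normalize y| <= 2 * `|x - y| / `|x|.
Proof.
rewrite -!normr_gt0 => x0 y0; rewrite /normalize.
have -> : `|x|^-1 *: x - `|y|^-1 *: y = `|x|^-1 *: (x - y) + (`|x|^-1 - `|y|^-1) *: y.
  by rewrite scalerBr scalerBl addrA subrK.
apply: le_trans (ler_normD _ _) _; rewrite !normrZ.
rewrite normfV normr_id -[`|_ - _| * `|y|]/(`|_ - _| * `|y|).
have -> : `|x|^-1 - `|y|^-1 = (`|y| - `|x|) / (`|x| * `|y|).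
  by field; rewrite ?lt0r_neq0.
rewrite normrM normfV normrM !normr_id.
have -> : `| `|y| - `|x| | / (`|x| * `|y|) * `|y| = `|x|^-1 * `| `|y| - `|x| |.
  by field; rewrite ?lt0r_neq0.
rewrite -mulrDr [leRHS]mulrC mulr_natl mulr2n.
apply: ler_wpM2l; [by rewrite invr_ge0 ltW|rewrite lerD2l].
by rewrite distrC (le_trans (ler_dist_dist _ _)).
Qed.

End Normalize.

Section GridPoints.
Context {R : realType} (n : nat).

Definition grid_point (c : seq int) : 'rV[R]_n := \row_k (c`_k)%:~R.

Lemma nth_map_opp (c : seq int) k : (map -%R c)`_k = - c`_k.
Proof.
case: (ltnP k (size c)) => h; first by rewrite (nth_map 0).
by rewrite !nth_default ?size_map // oppr0.
Qed.

Lemma grid_pointN c : grid_point (map -%R c) = - grid_point c.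
Proof. by apply/rowP => k; rewrite !mxE nth_map_opp rmorphN. Qed.

Lemma norm_grid_point N c : on_cube_boundary N n c -> N.*2%:R <= `|grid_point c|.
Proof.
case/andP=> /eqP sc /(has_nthP 0)[k kc /eqP ck].
have kn : (k < n)%N by rewrite -sc.
apply: le_trans (le_mx_norm_coord _ 0 (Ordinal kn)).
by rewrite mxE /= -intr_norm -abszE ck.
Qed.

Lemma grid_point_neq0 N c : (0 < N)%N -> on_cube_boundary N n c -> grid_point c != 0.
Proof.
move=> N0 /norm_grid_point; rewrite -normr_gt0; apply: lt_le_trans.
by rewrite ltr0n double_gt0.
Qed.

(** Radial projection has Lipschitz constant [2 / |x|] at [x], and here the norm of [x] is at least
    [2N]. *)
Lemma grid_point_near N (e : nat) c d : (0 < N)%N ->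
    on_cube_boundary N n c -> on_cube_boundary N n d ->
    (forall k, `|d`_k - c`_k| <= e%:Z) ->
  `|normalize (grid_point c) - normalize (grid_point d)| <= e%:R / N%:R.
Proof.
move=> N0 hc hd cd.
have h : `|grid_point c - grid_point d| <= e%:R.
  apply: mx_norm_le_coord => // i j; rewrite !mxE distrC -rmorphB -intr_norm.
  by rewrite -[e%:R]/(e%:Z%:~R) ler_int.
apply: le_trans (normalize_lipschitz (grid_point_neq0 N0 hc) (grid_point_neq0 N0 hd)) _.
rewrite ler_pdivrMr ?normr_gt0 ?(grid_point_neq0 N0 hc) //.
apply: (@le_trans _ _ (2 * e%:R)); first by rewrite ler_pM2l.
have -> : 2 * e%:R = e%:R / N%:R * N.*2%:R :> R.
  by rewrite -mul2n natrM; field; rewrite pnatr_eq0 -lt0n.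
by rewrite ler_wpM2l ?divr_ge0 // norm_grid_point.
Qed.
End GridPoints.

(* An odd sign on nonzero vectors, used where a coordinate of the map vanishes. *)
Fixpoint lex_pos (c : seq int) : bool :=
  if c is x :: c' then if x == 0 then lex_pos c' else 0 < x else false.

Lemma lex_pos_opp c : has (fun x => x != 0) c -> lex_pos (map -%R c) = ~~ lex_pos c.
Proof.
elim: c => [//|x c IH] /=; rewrite oppr_eq0; case: eqVneq => [//|x0 _].
by rewrite oppr_gt0 -leNgt le_eqVlt (negbTE x0).
Qed.

Lemma on_cube_boundary_has_neq0 N n c :
  (0 < N)%N -> on_cube_boundary N n c -> has (fun x => x != 0) c.
Proof.
move=> N0 /andP[_]; apply: sub_has => x /eqP xN.
by rewrite -absz_eq0 xN double_eq0 -lt0n.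
Qed.

(** * Zeros of maps that are odd in each variable *)

Section BiOddZero.
Context (R : realType) (m p : nat).
Local Notation V := 'rV[R]_m.+1.
Local Notation W := 'rV[R]_p.+1.
Context (G : V * W -> 'rV[R]_(m + p)).
Hypothesis Gcts : forall z, z.1 != 0 -> z.2 != 0 -> {for z, continuous G}.
Hypothesis GN1 : forall v w, v != 0 -> w != 0 -> G (- v, w) = - G (v, w).
Hypothesis GN2 : forall v w, v != 0 -> w != 0 -> G (v, - w) = - G (v, w).

(** The norms are maximum norms, so each factor is the boundary of a cube and contains the projected
    grid points. *)
Let K : set (V * W) := [set z | `|z.1| = 1 /\ `|z.2| = 1].

Lemma bi_sphere_compact : compact K.
Proof.
have cS n : compact [set x : 'rV[R]_n.+1 | `|x| = 1].
  apply: bounded_closed_compact.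
    by exists 1; split => // y y1 x /= ->; exact: ltW.
  apply: (@closed_comp _ _ (fun x : 'rV[R]_n.+1 => `|x|) [set 1]).
    by move=> x _; exact: norm_continuous.
  exact: closed_eq.
have -> : K = [set x | `|x| = 1] `*` [set x | `|x| = 1] by [].
exact: compact_setX.
Qed.

(** A Lebesgue number for the cover of [K] by the sets on which a given coordinate of [G] has a
    given strict sign. *)
Lemma sign_lebesgue_number : (forall z, K z -> G z != 0) ->
  \forall d \near 0^'+, forall z, K z -> exists i b, forall y, ball z d y ->
    if b then 0 < G y 0 i else G y 0 i < 0.
Proof.
move=> G0.
pose P d z := exists i b, forall y, ball z d y ->
    if b then 0 < G y 0 i else G y 0 i < 0.
suff : forall z, K z -> \forall z' \near z & d \near 0^'+, P d z'.
  exact: (iffLR (compact_near_coveringP K) bi_sphere_compact R).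
move=> z Kz.
have [i Gi] : exists i, G z 0 i != 0.
  apply/existsP; apply: contraR (G0 z Kz) => /existsPn h.
  by apply/eqP/rowP => i; rewrite mxE; apply/eqP/negPn/h.
have nz : z.1 != 0 /\ z.2 != 0.
  by case: Kz => z1 z2; split; rewrite -normr_eq0 ?z1 ?z2 oner_eq0.
have cG : {for z, continuous (fun y => G y 0 i)}.
  apply: (@continuous_comp _ _ _ G (fun M : 'rV[R]_(m + p) => M 0 i)).
    by apply: Gcts; case: nz.
  exact: coord_continuous.
have [b Hb] : exists b, \forall y \near z, if b then 0 < G y 0 i else G y 0 i < 0.
  move: Gi; rewrite neq_lt => /orP[] Gi; [exists false|exists true].
    exact: (cvgr_lt _ cG).
  exact: (cvgr_gt _ cG).
move/nbhs_ballP: Hb => [e /= e0 He].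
(* With both the displacement of the centre and the radius below [e / 2], the new ball stays inside
   the ball of radius [e] at [z]. *)
exists (ball z (e / 2), [set d | 0 < d < e / 2]) => /=.
  split; first by apply: nbhsx_ballx; rewrite divr_gt0.
  near=> d; rewrite /=; apply/andP; split; near: d; first exact: nbhs_right_gt.
  by apply: nbhs_right_lt; rewrite divr_gt0.
case=> z' d /= [zz' /andP[d0 de]]; exists i, b => y yd; apply: He.
rewrite [e]splitr; apply: ball_triangle zz' _.
by apply: le_ball yd; exact: ltW.
Unshelve. all: by end_near.
Qed.

(** Without a zero, some coordinate keeps a strict sign on each ball of a fixed radius [d] centred
    on [K]. A flag of a fine enough grid fits into such a ball, yet every coordinate changes sign on
    some flag. *)
Lemma bi_odd_zero : odd 'C(m + p, m) ->
  exists v w, [/\ v != 0, w != 0 & G (v, w) = 0].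
Proof.
move=> oC; apply: contrapT => noz.
have G0 v w : v != 0 -> w != 0 -> G (v, w) != 0.
  by move=> v0 w0; apply/eqP => Gvw; apply: noz; exists v, w.
have KG0 z : K z -> G z != 0.
  by case: z => v w [/= v1 w1]; apply: G0; rewrite -normr_eq0 ?v1 ?w1 oner_eq0.
have [d /= d0 Hd] : exists2 d : R, 0 < d & forall z, K z -> exists i b,
    forall y, ball z d y -> if b then 0 < G y 0 i else G y 0 i < 0.
  have /filter_ex[d [d0 hd]] : \forall d \near 0^'+, 0 < d /\ forall z, K z ->
      exists i b, forall y, ball z d y -> if b then 0 < G y 0 i else G y 0 i < 0.
    near=> d; split; first by near: d; exact: nbhs_right_gt.
    by near: d; exact: sign_lebesgue_number.
  by exists d.
have x0 : 0 <= (m + p)%:R / d by rewrite divr_ge0 // ltW.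
(* A flag makes [m + p] steps, so its projected points lie within [(m + p) / N < d] of the first
   one. *)
set N := Num.bound ((m + p)%:R / d); have := archi_boundP x0; rewrite -/N => hN.
have N0 : (0 < N)%N by rewrite -(ltr0n R) (le_lt_trans x0).
pose pt (z : seq int * seq int) : V * W :=
  (normalize (grid_point m.+1 z.1), normalize (grid_point p.+1 z.2)).
(* Signs are indexed by all naturals. The default 0 beyond [m + p] is compatible with oddness, and
   the lexicographic tie-break in [sg] then supplies the sign. *)
pose gc k (y : 'rV[R]_(m + p)) := if insub k is Some i then y 0 i else 0.
have gcN k y : gc k (- y) = - gc k y.
  by rewrite /gc; case: insubP => [i _ _|]; rewrite ?mxE ?oppr0.
pose sg k (z : seq int * seq int) := let g := gc k (G (pt z)) in
  if g == 0 then lex_pos z.1 (+) lex_pos z.2 else 0 < g.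
have nz n c : on_cube_boundary N n.+1 c -> normalize (grid_point n.+1 c) != 0 :> 'rV[R]_n.+1.
  by move=> h; rewrite -normr_eq0 norm_normalize ?oner_eq0 // (grid_point_neq0 N0 h).
have flipE (g : R) (b : bool) :
    (if - g == 0 then ~~ b else 0 < - g) = ~~ (if g == 0 then b else 0 < g).
  by rewrite oppr_eq0; case: eqVneq => // g0; rewrite oppr_gt0 -leNgt le_eqVlt (negbTE g0).
have sg1 k z : on_cube_boundary N m.+1 z.1 && on_cube_boundary N p.+1 z.2 ->
    sg k (opp1 z) = ~~ sg k z.
  case/andP => h1 h2; rewrite /sg /pt /= grid_pointN normalizeN GN1 ?nz // gcN.
  by rewrite lex_pos_opp ?(on_cube_boundary_has_neq0 N0 h1) // addNb flipE.
have sg2 k z : on_cube_boundary N m.+1 z.1 && on_cube_boundary N p.+1 z.2 ->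
    sg k (opp2 z) = ~~ sg k z.
  case/andP => h1 h2; rewrite /sg /pt /= grid_pointN normalizeN GN2 ?nz // gcN.
  by rewrite lex_pos_opp ?(on_cube_boundary_has_neq0 N0 h2) // addbN flipE.
have [z [l [/andP[gz1 gz2] gl zl changes]]] :=
  exists_sign_changing_flag sg1 sg2 (ltnSn m) (ltnSn p) oC.
have Kz : K (pt z) by split; apply: norm_normalize; apply: grid_point_neq0 N0 _.
have [i [b Hb]] := Hd _ Kz.
have [u [v [ul vl uv]]] := changes i (ltn_ord i).
suff sgE x : x \in z :: l -> sg i x = b by rewrite !sgE // eqxx in uv.
rewrite inE => xl.
have [gx1 gx2] : on_cube_boundary N m.+1 x.1 /\ on_cube_boundary N p.+1 x.2.
  by case/predU1P: xl => [->//|/(allP gl) /andP].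
have near_k k : `|x.1`_k - z.1`_k| <= (m + p)%:Z /\ `|x.2`_k - z.2`_k| <= (m + p)%:Z.
  by case/predU1P: xl => [->|/zl//]; rewrite !subrr normr0.
have lt_d : (m + p)%:R / N%:R < d.
  by rewrite ltr_pdivrMr ?ltr0n // mulrC -ltr_pdivrMr.
have /Hb : ball (pt z) d (pt x).
  by split; rewrite -ball_normE /=; apply: le_lt_trans lt_d;
    apply: grid_point_near => // k; case: (near_k k).
rewrite /sg /gc valK; case: b {Hb} => h.
  by rewrite gt_eqF // h.
by rewrite lt_eqF // ltNge ltW.
Unshelve. all: by end_near.
Qed.
End BiOddZero.

(** * Families of almost-embeddings *)

Section Topology.
Context {R : realType}.

Lemma continuous_at_coord (T : topologicalType) m n (f : T -> 'M[R]_(m, n)) z :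
  (forall i j, {for z, continuous (fun y => f y i j)}) -> {for z, continuous f}.
Proof.
move=> h; apply/cvgrPdist_le => e e0.
have : \forall y \near z, forall ij : 'I_m * 'I_n, `|f z ij.1 ij.2 - f y ij.1 ij.2| <= e.
  apply: filter_forall => -[i j].
  by move/cvgrPdist_le : (h i j); apply.
apply: filterS => y hy; apply: mx_norm_le_coord => [|i j]; first exact: ltW.
by rewrite !mxE; exact: (hy (i, j)).
Qed.

Lemma continuous_at_pair (S T U : topologicalType) (f : S -> T) (g : S -> U) z :
  {for z, continuous f} -> {for z, continuous g} ->
  {for z, continuous (fun x => (f x, g x))}.
Proof. by move=> cf cg; apply: cvg_pair; [exact: cf|exact: cg]. Qed.

Lemma continuous_at_set_type (T U : topologicalType) (A : set U) (f : T -> A) z :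
  {for z, continuous (set_val \o f)} -> {for z, continuous f}.
Proof.
move=> cf V [?/= [[W oW <-]]] /= Wfz /filterS; apply; apply: cf.
exact: open_nbhs_nbhs.
Qed.

(** Needed for the continuity of evaluation, where the domain is the subtype and not a subset of the
    ambient space. *)
Lemma compact_set_type (U : topologicalType) (A : set U) :
  compact A -> compact [set: A].
Proof.
move=> /compact_near_coveringP cA; apply/compact_near_coveringP => I F P FF h.
have : \near F, A `<=` (fun i x => forall (xA : x \in A), P i (exist _ x xA)) F.
  apply: cA => x Ax.
  have [[B C] [/= nB FC] BC] := h (exist _ x (mem_set Ax)) Logic.I.
  case: nB => [? [[Q oQ <-]]] /= Qx QB.
  exists (Q, C); first by split=> //; exact: open_nbhs_nbhs.
  by case=> y i [/= Qy Ci] yA; apply: (BC (exist _ y yA, i)); split => //; apply: QB.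
by apply: filterS => i hi [x xA] _; apply: hi; apply: set_mem.
Qed.

Lemma continuous_at_sum (T : topologicalType) (I : Type) (r : seq I)
    (f : I -> T -> R) z :
  (forall i, {for z, continuous (f i)}) ->
  {for z, continuous (fun y => \sum_(i <- r) f i y)}.
Proof.
move=> h; elim: r => [|i r IH].
  have -> : (fun y => \sum_(i <- [::]) f i y) = fun=> 0.
    by apply/funext => y; rewrite big_nil.
  exact: cvg_cst.
have -> : (fun y => \sum_(j <- i :: r) f j y) = f i \+ (fun y => \sum_(j <- r) f j y).
  by apply/funext => y; rewrite big_cons.
exact: continuousD (h i) IH.
Qed.
End Topology.

(** * Multiplication of polynomials as a bilinear map *)

Section PolynomialProduct.
Context {R : realType} {m p : nat}.

(** Rows are coefficient vectors. Sizes [m] and [p.+1] give a product of size at most [m + p], so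
    [poly_rV] truncates nothing and injectivity follows from the absence of zero divisors. *)
Definition mul_rV (v : 'rV[R]_m) (x : 'rV[R]_p.+1) : 'rV[R]_(m + p) :=
  poly_rV (rVpoly v * rVpoly x).

Lemma mul_rVNl v x : mul_rV (- v) x = - mul_rV v x.
Proof. by rewrite /mul_rV raddfN mulNr raddfN. Qed.

Lemma mul_rVBr v x y : mul_rV v (x - y) = mul_rV v x - mul_rV v y.
Proof. by rewrite /mul_rV raddfB mulrBr raddfB. Qed.

Lemma mul_rV_eq0 v x : v != 0 -> mul_rV v x = 0 -> x = 0.
Proof.
move=> v0 /(congr1 rVpoly); rewrite /mul_rV poly_rV_K ?raddf0; last first.
  apply: leq_trans (size_polyMleq _ _) _.
  have := size_poly m (fun k => if insub k is Some i then v 0 i else 0).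
  have := size_poly p.+1 (fun k => if insub k is Some i then x 0 i else 0).
  rewrite -/(rVpoly v) -/(rVpoly x); lia.
move=> /eqP; rewrite mulf_eq0 => /orP[] /eqP /(congr1 (@poly_rV _ _)) => h.
  by move: (h m); rewrite rVpolyK raddf0 => /eqP; rewrite (negbTE v0).
by move: (h p.+1); rewrite rVpolyK raddf0.
Qed.

Lemma mul_rV_continuous : continuous (fun vx => mul_rV vx.1 vx.2).
Proof.
move=> z; apply: continuous_at_coord => i k; rewrite ord1.
have -> : (fun y : 'rV[R]_m * 'rV[R]_p.+1 => mul_rV y.1 y.2 0 k) =
    (fun y => \sum_(j < k.+1) (rVpoly y.1)`_j * (rVpoly y.2)`_(k - j)).
  by apply/funext => y; rewrite mxE coefM.
have coef_cts n (f : 'rV[R]_m * 'rV[R]_p.+1 -> 'rV[R]_n) j :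
    continuous f -> {for z, continuous (fun y => (rVpoly (f y))`_j)}.
  move=> cf.
  have -> : (fun y => (rVpoly (f y))`_j) =
      fun y => if insub j is Some l then f y 0 l else 0.
    by apply/funext => y; rewrite coef_rVpoly.
  case: insub => [l|]; last exact: cvg_cst.
  apply: (@continuous_comp _ _ _ f (fun M : 'rV[R]_n => M 0 l)); first exact: cf.
  exact: coord_continuous.
apply: continuous_at_sum => j; apply: continuousM; apply: coef_cts.
  by move=> y; exact: cvg_fst.
by move=> y; exact: cvg_snd.
Qed.
End PolynomialProduct.

Lemma const1_neq0 (R : realType) n : const_mx 1 != 0 :> 'rV[R]_n.+1.
Proof. by apply/eqP => /rowP /(_ 0); rewrite !mxE => /eqP; rewrite oner_eq0. Qed.

(** * Equatorial spheres *)

Section ToSphere.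
Context {R : realType} {m e : nat}.
Implicit Types v : 'rV[R]_m.+1.

Definition l2_norm v : R := Num.sqrt (\sum_i v 0 i ^+ 2).

Lemma l2_norm_gt0 v : v != 0 -> 0 < l2_norm v.
Proof.
move=> v0; rewrite sqrtr_gt0 lt0r sumr_ge0 ?andbT => [|i _]; last exact: sqr_ge0.
apply: contra v0; rewrite psumr_eq0 => [/allP h|i _]; last exact: sqr_ge0.
apply/eqP/rowP => i; rewrite mxE; apply/eqP.
by have := h i; rewrite mem_index_enum sqrf_eq0 => /(_ isT).
Qed.

(** Restricting along this inclusion of [S^m] as an equator of [S^(m + e)] treats all spheres of
    dimension at least [m] at once. *)
Definition padded_unit v : 'rV[R]_(m.+1 + e) := (l2_norm v)^-1 *: row_mx v 0.

Lemma padded_unit_sphere v : v != 0 -> unit_sphere R _ (padded_unit v).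
Proof.
move=> /l2_norm_gt0 v0; rewrite /unit_sphere /= big_split_ord /=.
rewrite [X in _ + X]big1 ?addr0 => [|i _]; last by rewrite mxE row_mxEr mxE mulr0 expr0n.
under eq_bigr do rewrite mxE row_mxEl exprMn.
rewrite -mulr_sumr exprVn sqr_sqrtr ?sumr_ge0 // => [|i _]; last exact: sqr_ge0.
by rewrite mulVf // gt_eqF // -sqrtr_gt0.
Qed.

Lemma padded_unitN v : padded_unit (- v) = - padded_unit v.
Proof.
rewrite /padded_unit.
have -> : row_mx (- v) 0 = - row_mx v (0 : 'rV[R]_e) by rewrite opp_row_mx oppr0.
rewrite scalerN; congr (- (_^-1 *: _)); congr Num.sqrt.
by apply: eq_bigr => i _; rewrite mxE sqrrN.
Qed.

Lemma padded_unit_continuous v : v != 0 -> {for v, continuous padded_unit}.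
Proof.
move=> v0; apply: continuous_at_coord => i j; rewrite ord1.
have -> : (fun w => padded_unit w 0 j) =
    (fun w => (l2_norm w)^-1 * (row_mx w (0 : 'rV[R]_e)) 0 j).
  by apply/funext => w; rewrite mxE.
apply: continuousM.
  apply: continuousV; first by rewrite gt_eqF // l2_norm_gt0.
  apply: continuous_comp; last exact: sqrt_continuous.
  apply: continuous_at_sum => k.
  apply: (@continuous_comp _ _ _ (fun w : 'rV[R]_m.+1 => w 0 k) (fun x => x ^+ 2)).
    exact: coord_continuous.
  exact: exprn_continuous.
case: (split_ordP j) => k ->.
  have -> : (fun w => row_mx w (0 : 'rV[R]_e) 0 (lshift e k)) = (fun w => w 0 k).
    by apply/funext => w; rewrite row_mxEl.
  exact: coord_continuous.
have -> : (fun w => row_mx w (0 : 'rV[R]_e) 0 (rshift m.+1 k)) = cst (0 : R).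
  by apply/funext => w; rewrite row_mxEr mxE.
by apply: cvg_cst; exact: nbhs_filter.
Qed.

(** Made total on the vector space: the zero vector gets an arbitrary point of the sphere, and only
    nonzero vectors matter. *)
Definition to_sphere v : unit_sphere R (m.+1 + e) :=
  if pselect (unit_sphere R _ (padded_unit v)) is left h
  then exist _ (padded_unit v) (mem_set h)
  else exist _ (padded_unit _) (mem_set (padded_unit_sphere (const1_neq0 R m))).

Lemma to_sphereE v : v != 0 -> set_val (to_sphere v) = padded_unit v.
Proof. by move=> /padded_unit_sphere v0; rewrite /to_sphere; case: pselect. Qed.

Lemma to_sphere_continuous v : v != 0 -> {for v, continuous to_sphere}.
Proof.
move=> v0; apply: continuous_at_set_type.
rewrite /prop_for /continuous_at /= to_sphereE //.
have FF : Filter (nbhs v) by exact: nbhs_filter.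
have nz : \forall w \near v, w != 0 by apply: (cvgr_neq0 v cvg_id v0).
have eqE : {near v, padded_unit =1 set_val \o to_sphere}.
  by apply: filterS nz => w w0; rewrite /= to_sphereE.
exact: cvg_trans (near_eq_cvg eqE) (padded_unit_continuous v0).
Qed.
End ToSphere.

(** * From zero-sum directions to the boundary of the simplex *)

Section ToBoundary.
Context {R : realType} {p : nat}.
Implicit Types w : 'rV[R]_p.+1.

(** A linear parametrisation of the hyperplane of zero coordinate sum: the first coordinate balances
    the others. *)
Definition sum_zero w : 'rV[R]_p.+2 :=
  \row_i if unlift ord0 i is Some j then w 0 j else - \sum_j w 0 j.

Lemma sum_sum_zero w : \sum_i sum_zero w 0 i = 0.
Proof.
rewrite big_ord_recl mxE unlift_none addrC; apply/eqP; rewrite subr_eq0; apply/eqP.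
by apply: eq_bigr => i _; rewrite mxE liftK.
Qed.

Lemma sum_zeroN w : sum_zero (- w) = - sum_zero w.
Proof.
apply/rowP => i; rewrite !mxE; case: unliftP => [j _|_]; first by rewrite mxE.
by congr (- _); rewrite -sumrN; apply: eq_bigr => j _; rewrite mxE.
Qed.

Lemma sum_zero_continuous i : continuous (fun w => sum_zero w 0 i).
Proof.
move=> w; case: (unliftP ord0 i) => [j ->|->].
  have -> : (fun w => sum_zero w 0 (lift ord0 j)) = (fun w => w 0 j).
    by apply/funext => y; rewrite mxE liftK.
  exact: coord_continuous.
have -> : (fun w => sum_zero w 0 ord0) = (fun w => - \sum_j w 0 j).
  by apply/funext => y; rewrite mxE unlift_none.
by apply: continuousN; apply: continuous_at_sum => j; exact: coord_continuous.
Qed.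

Lemma sum_zero_gt0 w : w != 0 -> exists i, 0 < sum_zero w 0 i.
Proof.
move=> w0; apply/existsP; apply: contraNT w0 => /existsPn h.
have le0 i : 0 <= - sum_zero w 0 i by rewrite oppr_ge0 leNgt h.
have : \sum_i - sum_zero w 0 i == 0 by rewrite sumrN sum_sum_zero oppr0.
rewrite psumr_eq0 // => /allP h0; apply/eqP/rowP => j.
have := h0 (lift ord0 j); rewrite mem_index_enum mxE liftK oppr_eq0 mxE.
by move=> /(_ isT)/eqP.
Qed.

Lemma sum_zero_lt0 w : w != 0 -> exists i, sum_zero w 0 i < 0.
Proof.
rewrite -oppr_eq0 => /sum_zero_gt0[i]; rewrite sum_zeroN mxE oppr_gt0 => hi.
by exists i.
Qed.

Definition pos_mass w : R := \sum_i Num.max (sum_zero w 0 i) 0.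

Lemma pos_mass_gt0 w : w != 0 -> 0 < pos_mass w.
Proof.
move=> /sum_zero_gt0[i hi]; rewrite /pos_mass (bigD1 i) //= ltr_pwDl //.
  by rewrite lt_max hi.
by apply: sumr_ge0 => j _; rewrite le_max lexx orbT.
Qed.

Definition pos_bary w : 'rV[R]_p.+2 :=
  \row_i (Num.max (sum_zero w 0 i) 0 / pos_mass w).

Lemma pos_bary_neq0 w i : w != 0 -> (pos_bary w 0 i != 0) = (0 < sum_zero w 0 i).
Proof.
move=> /pos_mass_gt0 w0; rewrite mxE mulf_eq0 invr_eq0 (gt_eqF w0) orbF.
by case: (ltP 0 (sum_zero w 0 i)) => h; rewrite ?eqxx // gt_eqF.
Qed.

(** A zero-sum direction [w != 0] has a negative coordinate, and the corresponding vertex is missing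
    from the support, which is therefore a proper face. *)
Lemma pos_bary_realization w :
  w != 0 -> realization R (simplex_boundary p.+1) (pos_bary w).
Proof.
move=> w0; have m0 := pos_mass_gt0 w0; split.
- by move=> i; rewrite mxE divr_ge0 ?(ltW m0) // le_max lexx orbT.
- by under eq_bigr do rewrite mxE; rewrite -mulr_suml divff // gt_eqF.
- rewrite inE properT; have [i hi] := sum_zero_lt0 w0.
  apply/negP => /eqP/setP/(_ i); rewrite !inE pos_bary_neq0 //.
  by rewrite ltNge ltW.
Qed.

Lemma pos_bary_continuous w : w != 0 -> {for w, continuous pos_bary}.
Proof.
move=> w0; apply: continuous_at_coord => i j; rewrite ord1.
have max_cts k : {for w, continuous (fun y => Num.max (sum_zero y 0 k) 0)}.
  apply: (@continuous_max _ _ (fun y => sum_zero y 0 k) (fun=> 0)).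
    exact: sum_zero_continuous.
  by apply: cvg_cst; exact: nbhs_filter.
have -> : (fun y => pos_bary y 0 j) =
    (fun y => Num.max (sum_zero y 0 j) 0 / pos_mass y).
  by apply/funext => y; rewrite mxE.
apply: continuousM; first exact: max_cts.
apply: continuousV; first by rewrite gt_eqF // pos_mass_gt0.
exact: continuous_at_sum.
Qed.

Definition to_boundary w : realization R (simplex_boundary p.+1) :=
  if pselect (realization R (simplex_boundary p.+1) (pos_bary w)) is left h
  then exist _ (pos_bary w) (mem_set h)
  else exist _ (pos_bary _) (mem_set (pos_bary_realization (const1_neq0 R p))).

Lemma to_boundaryE w : w != 0 -> set_val (to_boundary w) = pos_bary w.
Proof. by move=> /pos_bary_realization w0; rewrite /to_boundary; case: pselect. Qed.

Lemma to_boundary_continuous w : w != 0 -> {for w, continuous to_boundary}.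
Proof.
move=> w0; apply: continuous_at_set_type.
rewrite /prop_for /continuous_at /= to_boundaryE //.
have FF : Filter (nbhs w) by exact: nbhs_filter.
have nz : \forall y \near w, y != 0 by apply: (cvgr_neq0 w cvg_id w0).
have eqE : {near w, pos_bary =1 set_val \o to_boundary}.
  by apply: filterS nz => y y0; rewrite /= to_boundaryE.
exact: cvg_trans (near_eq_cvg eqE) (pos_bary_continuous w0).
Qed.
End ToBoundary.

(** A point of the simplex is on the boundary exactly when some coordinate vanishes, which is a
    finite union of closed conditions. *)
Lemma realization_compact (R : realType) n : compact (realization R (simplex_boundary n)).
Proof.
apply: bounded_closed_compact.
  exists 1; split => // y y1 x /= [x0 x1 _]; apply: mx_norm_le_coord => [|i j].
    by rewrite ltW // (lt_trans _ y1).
  rewrite ord1 ger0_norm // (le_trans _ (ltW y1)) // -x1 (bigD1 j) //= lerDl.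
  by apply: sumr_ge0.
have -> : realization R (simplex_boundary n) =
    \bigcap_(i in setT) [set x | 0 <= x ord0 i] `&` [set x | \sum_i x ord0 i = 1] `&`
    \bigcup_(i in setT) [set x | x ord0 i = 0].
  apply/seteqP; split => x /=.
    case=> x0 x1; rewrite inE properT => xs; split; first by split => // i _; exact: x0.
    have /existsP[i] : [exists i, x ord0 i == 0].
      apply: contraNT xs => /existsPn h; apply/eqP/setP => i.
      by rewrite !inE h.
    by move/eqP => xi; exists i.
  case=> -[x0 x1] [i _ xi]; split=> //; first by move=> j; exact: x0.
  by rewrite inE properT; apply/negP => /eqP/setP/(_ i); rewrite !inE xi eqxx.
apply: closedI; first apply: closedI.
- apply: closed_bigI => i _.
  apply: (@closed_comp _ _ (fun x : 'rV[R]_n.+1 => x ord0 i) [set y | 0 <= y]).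
    by move=> x _; exact: coord_continuous.
  exact: closed_ge.
- apply: (@closed_comp _ _ (fun x : 'rV[R]_n.+1 => \sum_i x ord0 i) [set 1]).
    by move=> x _; apply: continuous_at_sum => i; exact: coord_continuous.
  exact: closed_eq.
- apply: closed_bigcup; first exact: finite_finset.
  move=> i _; apply: (@closed_comp _ _ (fun x : 'rV[R]_n.+1 => x ord0 i) [set 0]).
    by move=> x _; exact: coord_continuous.
  exact: closed_eq.
Qed.

(** * The lower and upper bounds for the coindex *)

Section Bounds.
Import ArrowAsCompactOpen.
Context {R : realType} (m p : nat).
Local Notation K := (simplex_boundary p.+1).
Local Notation Y := (AEmb_z2 R K (m + p)).

Lemma sphere_neq0 n (v : unit_sphere R n) : set_val v != 0.
Proof.
apply/eqP => v0; have := set_mem (valP v); rewrite /unit_sphere /= -[\val v]/(set_val v) v0.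
rewrite big1 => [/esym/eqP|i _]; first by rewrite oner_eq0.
by rewrite mxE expr0n.
Qed.

(** Embeds the simplex in [R^(p+1)]: vertex 0 goes to [(-1, ..., -1)] and the other vertices go to
    the standard basis. *)
Definition edge_vectors (x : 'rV[R]_p.+2) : 'rV[R]_p.+1 :=
  \row_j (x 0 (lift ord0 j) - x 0 ord0).

(** The differences determine the coordinates up to a common constant, which the sum fixes. *)
Lemma edge_vectors_inj (x y : 'rV[R]_p.+2) : \sum_i x 0 i = \sum_i y 0 i ->
  edge_vectors x = edge_vectors y -> x = y.
Proof.
move=> sxy exy.
have h i : x 0 i - x 0 ord0 = y 0 i - y 0 ord0.
  case: (unliftP ord0 i) => [j ->|->]; last by rewrite !subrr.
  by move/rowP/(_ j) : exy; rewrite !mxE.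
have e0 : x 0 ord0 = y 0 ord0.
  have : \sum_i (x 0 i - x 0 ord0) = \sum_i (y 0 i - y 0 ord0).
    by apply: eq_bigr => i _.
  rewrite !big_split /= sxy => /addrI; rewrite !sumr_const card_ord.
  by move/eqP; rewrite eqr_pMn2r // eqr_opp => /eqP.
apply/rowP => i; apply/eqP; rewrite -subr_eq0.
by rewrite -[x 0 i](subrK (x 0 ord0)) h e0 subrK subrr.
Qed.

Lemma edge_vectors_continuous : continuous edge_vectors.
Proof.
move=> x; apply: continuous_at_coord => i j; rewrite ord1.
have -> : (fun y => edge_vectors y 0 j) = (fun y => y 0 (lift ord0 j) - y 0 ord0).
  by apply/funext => y; rewrite mxE.
by apply: continuousB; exact: coord_continuous.
Qed.

Definition product_family (vx : unit_sphere R m * realization R K) : 'rV[R]_(m + p) :=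
  mul_rV (set_val vx.1) (edge_vectors (set_val vx.2)).

Lemma product_family_continuous : continuous product_family.
Proof.
move=> z.
apply: (@continuous_comp _ _ _ (fun vx : unit_sphere R m * realization R K =>
  (set_val vx.1, edge_vectors (set_val vx.2))) (fun vx => mul_rV vx.1 vx.2)); last first.
  exact: mul_rV_continuous.
apply: continuous_at_pair.
  apply: (@continuous_comp _ _ _ (fun vx : unit_sphere R m * realization R K => vx.1) set_val).
    exact: cvg_fst.
  exact: initial_continuous.
apply: (@continuous_comp _ _ _ (fun vx : unit_sphere R m * realization R K => vx.2)
  (edge_vectors \o set_val)); first exact: cvg_snd.
apply: continuous_comp; first exact: initial_continuous.
exact: edge_vectors_continuous.
Qed.

Definition product_map (v : unit_sphere R m) :
    continuousType (realization R K) 'rV[R]_(m + p) :=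
  mkcts ((continuous_curry product_family_continuous).2 v).

(** The map is injective, and a point common to both faces would have its nonempty support in two
    disjoint sets. *)
Lemma product_map_AEmb v : AEmb R K (m + p) (product_map v).
Proof.
move=> s t _ _ st; rewrite -subset0 => y [[a sa <-] [b tb]].
move=> /eqP; rewrite -subr_eq0 -mul_rVBr => /eqP /(mul_rV_eq0 (sphere_neq0 v)).
move/eqP; rewrite subr_eq0 => /eqP ba.
have [a0 a1 _] := set_mem (valP a); have [b0 b1 _] := set_mem (valP b).
have {}ba : \val b = \val a by apply: edge_vectors_inj => //; rewrite a1 b1.
have [i ai] : exists i, (\val a : 'rV_p.+2) ord0 i != 0.
  apply/existsP; apply: contraT => /existsPn h; move: a1.
  rewrite big1 => [/esym/eqP|i _]; first by rewrite oner_eq0.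
  by apply/eqP; move: (h i); rewrite negbK.
have si := sa i ai.
have ti : i \in t by apply: tb; rewrite ba.
by move/pred0P/(_ i) : st; rewrite /= si ti.
Qed.

Definition product_section (v : antipodal_sphere R m) : Y :=
  exist _ (product_map v) (mem_set (product_map_AEmb v)).

(** Currying turns the joint continuity of [product_family] into continuity for the compact-open
    topology. *)
Lemma product_section_continuous : continuous product_section.
Proof.
apply: continuous_comp_initial; apply: continuous_comp_initial.
exact: (continuous_curry product_family_continuous).1.
Qed.

Lemma product_section_equivariant : equivariant product_section.
Proof.
move=> v; apply/val_inj/continuousEP => x /=.
exact: mul_rVNl.
Qed.

(** Evaluation is jointly continuous because the domain is compact and regular. *)
Lemma realization_eval_continuous :
  continuous (eval :
    continuousType (realization R K) 'rV[R]_(m + p) * realization R K -> _).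
Proof.
apply: eval_continuous; last exact: uniform_regular.
move=> x _; rewrite withinET; exists setT; first exact: filterT.
split; last exact: closedT.
exact: compact_set_type (@realization_compact R p.+1).
Qed.

Lemma AEmb_coind_upper e (f : antipodal_sphere R (m.+1 + e) -> Y) :
  odd 'C(m + p, m) -> continuous f -> ~ equivariant f.
Proof.
move=> oC cf ef.
pose F (v : 'rV[R]_m.+1) (w : 'rV[R]_p.+1) : 'rV[R]_(m + p) :=
  eval (\val (f (to_sphere (e := e) v)), to_boundary w).
(* Oddness in the first variable comes from the equivariance of [f], in the second from
   antisymmetrisation. A zero is a coincidence of values on opposite directions. *)
pose G (z : 'rV[R]_m.+1 * 'rV[R]_p.+1) := F z.1 z.2 - F z.1 (- z.2).
have FN v w : v != 0 -> F (- v) w = - F v w.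
  move=> v0; rewrite /F.
  have -> : to_sphere (e := e) (- v) = z2act (to_sphere (e := e) v : antipodal_sphere R _).
    apply/val_inj; rewrite /= -[LHS]/(set_val _) to_sphereE ?oppr_eq0 // padded_unitN.
    by rewrite -to_sphereE.
  by rewrite ef.
have Fcts z : z.1 != 0 -> z.2 != 0 -> {for z, continuous (fun z => F z.1 z.2)}.
  move=> z1 z2.
  apply: (@continuous_comp _ _ _ (fun z : 'rV[R]_m.+1 * 'rV[R]_p.+1 =>
    (\val (f (to_sphere (e := e) z.1)), to_boundary z.2)) eval); last first.
    exact: realization_eval_continuous.
  apply: continuous_at_pair; last first.
    apply: (@continuous_comp _ _ _ snd to_boundary); first exact: cvg_snd.
    exact: to_boundary_continuous.
  apply: (@continuous_comp _ _ _ (fun z : 'rV[R]_m.+1 * 'rV[R]_p.+1 => to_sphere (e := e) z.1)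
    (set_val \o f)).
    apply: (@continuous_comp _ _ _ fst (to_sphere (e := e))); first exact: cvg_fst.
    exact: to_sphere_continuous.
  apply: continuous_comp; first exact: cf.
  exact: initial_continuous.
have [v [w [v0 w0]]] : exists v w, [/\ v != 0, w != 0 & G (v, w) = 0].
  apply: bi_odd_zero oC.
  - move=> z z1 z2; apply: continuousB; first exact: Fcts.
    apply: (@continuous_comp _ _ _ (fun z : 'rV[R]_m.+1 * 'rV[R]_p.+1 => (z.1, - z.2))
      (fun z => F z.1 z.2)); last by apply: Fcts; rewrite ?oppr_eq0.
    apply: continuous_at_pair; first exact: cvg_fst.
    by apply: cvgN; exact: cvg_snd.
  - by move=> v w v0 w0; rewrite /G /= !FN // opprB opprK addrC.
  - by move=> v w v0 w0; rewrite /G /= opprK opprB.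
have nw0 : - w != 0 by rewrite oppr_eq0.
move=> /eqP; rewrite subr_eq0 /= => /eqP Fvw.
have fA := set_mem (valP (f (to_sphere (e := e) v))).
(* For [- w] this is the set of negative coordinates of [w], so the two faces are disjoint and the
   coincidence contradicts almost-embedding. *)
pose supp (y : 'rV[R]_p.+1) : {set 'I_p.+2} := [set i | 0 < sum_zero y 0 i]%SET.
have suppP y : y != 0 -> supp y \in faces K.
  move=> y0; have [_ _ h] := pos_bary_realization y0.
  suff -> : supp y = [set i | pos_bary y ord0 i != 0]%SET by [].
  by apply/setP => i; rewrite !inE pos_bary_neq0.
have supp_face y : y != 0 -> face_realization R K (supp y) (to_boundary y).
  by move=> y0 i; rewrite -[\val _]/(set_val _) to_boundaryE // pos_bary_neq0 // inE.
have disj : [disjoint supp w & supp (- w)]%B.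
  apply/pred0P => i; rewrite /= !inE.
  have -> : sum_zero (- w) 0 i = - sum_zero w 0 i by rewrite sum_zeroN mxE.
  rewrite oppr_gt0.
  by case: ltgtP.
have := fA _ _ (suppP _ w0) (suppP _ nw0) disj.
rewrite -subset0 => /(_ (F v w)); apply; split.
  by exists (to_boundary w) => //; exact: supp_face.
by exists (to_boundary (- w)); [exact: supp_face|rewrite Fvw].
Qed.
End Bounds.

Theorem corollary1p4 (R : realType) (p d : nat)
    (hpd : (p <= d)%N) (hbin : ~ share_binary_one p (d - p)%N) :
  is_coind R (AEmb_z2 R (simplex_boundary p.+1) d) (d%:Z - p%:Z - 1).
Proof.
have [m dE] : exists m, d = (m + p)%N by exists (d - p)%N; rewrite subnK.
move: hbin; subst d; rewrite addnK => /no_shared_binary_one_odd_bin oC.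
have -> : (m + p)%:Z - p%:Z - 1 = m%:Z - 1 by lia.
split.
  split; first by lia.
  have -> : `|(m%:Z - 1 + 1)%R|%N = m by lia.
  exists (@product_section R m p); split.
    exact: product_section_continuous.
  exact: product_section_equivariant.
move=> k [k1 [f [cf ef]]]; rewrite leNgt; apply/negP => mk.
(* The sphere [S^k] lies in dimension [k + 1], and [k > m - 1] makes this at least [m + 1]. *)
have [e kE] : exists e, `|(k + 1)%R|%N = (m.+1 + e)%N.
  by exists (`|(k + 1)%R|%N - m.+1)%N; lia.
move: f cf ef; rewrite kE => f cf ef.
by apply: AEmb_coind_upper cf ef; rewrite -bin_sub ?leq_addr // addKn addnC.
Qed.
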